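(* For every $m\in\mathbb{N}\setminus\{0\}$, there exists a Lipschitz continuous and piecewise-$C^\infty$ function $f\colon\mathbb{R}^m\to\mathbb{R}$ that is not locally $C^1$ on a set of positive Lebesgue measure; that is, there is a set of positive Lebesgue measure in $\mathbb{R}^m$ consisting of points $x$ having no neighborhood on which $f$ is $C^1$.
   Context: A continuous function $f\colon\mathbb{R}^m\to\mathbb{R}$ is piecewise-$C^\infty$ if there exist a finite Borel partition $\mathbb{R}^m=\bigsqcup_{j=1}^J P^j$ (nonempty, pairwise disjoint Borel sets) and $C^\infty$ functions $f^1,\ldots,f^J\colon\mathbb{R}^m\to\mathbb{R}$ with $f(x)=f^j(x)$ whenever $x\in P^j$. *)

(* Defs.v *)
From HB Require Import structures.
From mathcomp Require Import all_boot all_order all_algebra.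
From mathcomp Require Import all_classical all_reals all_analysis.

Set Implicit Arguments.
Unset Strict Implicit.
Unset Printing Implicit Defensive.

Import Order.TTheory GRing.Theory Num.Theory.
Import numFieldNormedType.Exports.

Local Open Scope classical_set_scope.
Local Open Scope ring_scope.

(* The norm on 'rV[R]_m is the sup norm. All norms on R^m being equivalent,
   the notions below (topology, Borel sets, partial derivatives) and Lipschitz
   continuity do not depend on this choice. *)

Section differentiability_classes.
Context {R : realType} {m : nat}.
Implicit Types (f : 'rV[R]_m -> R) (U : set 'rV[R]_m).

(* All partial derivatives of f of order at most k exist and are continuous
   at every point of U; meant for open U. *)
Fixpoint Ck_on (k : nat) U f : Prop :=
  (forall x, U x -> {for x, continuous f}) /\
  if k is k'.+1 then
    forall i : 'I_m,
      (forall x, U x -> derivable f x (delta_mx 0 i)) /\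
      Ck_on k' U ('D_(delta_mx 0 i) f)
  else True.

Definition smooth f : Prop := forall k, Ck_on k setT f.

Definition locally_C1 f (x : 'rV[R]_m) : Prop :=
  exists U, open_nbhs x U /\ Ck_on 1 U f.

Definition borel : set (set 'rV[R]_m) := <<s [set U | open U] >>.

Definition piecewise_smooth f : Prop :=
  continuous f /\
  exists (J : nat) (P : 'I_J -> set 'rV[R]_m) (g : 'I_J -> 'rV[R]_m -> R),
    [/\ forall j, borel (P j) /\ P j !=set0,
        trivIset setT P,
        \bigcup_j P j = setT,
        forall j, smooth (g j)
      & forall j x, P j x -> f x = g j x].

End differentiability_classes.

Section lebesgue_outer_measure.
Local Open Scope ereal_scope.
Context {R : realType} {m : nat}.

Definition box (a b : 'rV[R]_m) : set 'rV[R]_m :=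
  [set x | forall i, (a 0 i < x 0 i <= b 0 i)%R].

Definition box_volume (a b : 'rV[R]_m) : \bar R :=
  (\prod_i (b 0 i - a 0 i))%:E.

Definition box_cover (A : set 'rV[R]_m) : set (nat -> 'rV[R]_m * 'rV[R]_m) :=
  [set I : nat -> 'rV[R]_m * 'rV[R]_m |
    (forall k i, ((I k).1 0 i <= (I k).2 0 i)%R) /\
    A `<=` \bigcup_k box (I k).1 (I k).2].

(* Degenerate for m = 0: every cover then has infinite total volume. *)
Definition lebesgue_outer (A : set 'rV[R]_m) : \bar R :=
  ereal_inf [set \sum_(k <oo) box_volume (I k).1 (I k).2 | I in box_cover A].

End lebesgue_outer_measure.

Section lebesgue_outer_measure_theory.
Local Open Scope ereal_scope.
Context {R : realType} {m : nat}.
Local Notation mu := (@lebesgue_outer R m.+1).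
Implicit Types A : set 'rV[R]_m.+1.

Let vol (p : 'rV[R]_m.+1 * 'rV[R]_m.+1) := box_volume p.1 p.2.

Let vol_ge0 A I k : box_cover A I -> 0 <= vol (I k).
Proof.
move=> [I_le _]; rewrite lee_fin; apply: prodr_ge0 => i _.
by rewrite subr_ge0.
Qed.

Let sum_vol_ge0 A I : box_cover A I -> 0 <= \sum_(k <oo) vol (I k).
Proof. by move=> AI; apply: nneseries_ge0 => k _ _; exact: (vol_ge0 k AI). Qed.

Lemma lebesgue_outer_ge0 A : 0 <= mu A.
Proof. by apply: le_ereal_inf_tmp => _ [I AI <-]; exact: sum_vol_ge0 AI. Qed.

Lemma lebesgue_outer0 : mu set0 = 0.
Proof.
apply/eqP; rewrite eq_le lebesgue_outer_ge0 andbT.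
apply: ereal_inf_lbound; exists (fun=> (0%R, 0%R)); first by split.
apply: eseries0 => k _ _.
by rewrite /box_volume big_ord_recl/= subrr mul0r.
Qed.

Lemma le_lebesgue_outer : {homo mu : A B / A `<=` B >-> A <= B}.
Proof.
move=> A B AB; apply/ereal_inf_le_tmp => _ [I [I_le BI] <-].
by exists I => //; split => //; exact: subset_trans BI.
Qed.

Lemma lebesgue_outer_sigma_subadditive : sigma_subadditive mu.
Proof.
move=> A; have [[i ioo]|] := pselect (exists i, mu (A i) = +oo).
  rewrite (eseries_pinfty _ _ ioo) ?leey// => n _.
  by rewrite -ltNye (lt_le_trans _ (lebesgue_outer_ge0 _)).
rewrite -forallNE => Aoo.
suff add2e (e : {posnum R}) :
    mu (\bigcup_n A n) <= \sum_(i <oo) mu (A i) + e%:num%:E.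
  by apply/lee_addgt0Pr => _/posnumP[].
rewrite (le_trans _ (epsilon_trick _ _ _))//; last first.
  by move=> n; exact: lebesgue_outer_ge0.
pose P n I := box_cover (A n) I /\
  \sum_(k <oo) vol (I k) <= mu (A n) + (e%:num / (2 ^ n.+1)%:R)%:E.
have [G PG] : {G : nat -> nat -> 'rV[R]_m.+1 * 'rV[R]_m.+1
    & forall n, P n (G n)}.
  apply: (@choice _ _ P) => n.
  have en1 : (0 < e%:num / (2 ^ n.+1)%:R :> R)%R by [].
  have fA : mu (A n) \is a fin_num.
    rewrite ge0_fin_numE ?lebesgue_outer_ge0// ltey.
    by apply/eqP; exact: Aoo.
  have [_ [I AI <-] /ltW ?] := lb_ereal_inf_adherent en1 fA.
  by exists I.
have volG_ge0 x : 0 <= (vol \o uncurry G) x.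
  by case: x => n k; exact: (vol_ge0 k (PG n).1).
apply: (@le_trans _ _ (\esum_(i in setT) (vol \o uncurry G) i)).
  apply: ereal_inf_lbound => /=.
  have /card_esym/ppcard_eqP[f] := card_nat2.
  exists (uncurry G \o f).
    split => [k i|].
      by rewrite /= /uncurry; case: (f k) => a b; exact: (PG a).1.1.
    move=> t [n _ /(PG n).1.2[k _ Gnkt]]; exists (f^-1%FUN (n, k)) => //=.
    by rewrite invK ?inE.
  rewrite -(esum_pred_image (vol \o uncurry G) _ xpredT) ?[fun=> _]set_true//.
  by rewrite image_eq.
rewrite (_ : esum _ _ = \sum_(i <oo) \sum_(j <oo) vol (G i j)); last first.
  pose J : nat -> set (nat * nat) := fun i => [set (i, j) | j in setT].
  rewrite (_ : setT = \bigcup_k J k); last first.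
    by rewrite predeqE => -[a b]; split => // _; exists a => //; exists b.
  rewrite esum_bigcupT /=; last 2 first.
    - apply/trivIsetP => i j _ _ ij.
      rewrite predeqE => -[n k] /=; split => //= -[] [_] _ [<-{n} _].
      by move=> [k' _] [] /esym/eqP; rewrite (negbTE ij).
    - by move=> x; exact: volG_ge0.
  rewrite -(image_id [set: nat]) -fun_true esum_pred_image//; last first.
    by move=> n _; apply: esum_ge0 => x _; exact: volG_ge0.
  apply: eq_eseriesr => /= j _.
  rewrite -(esum_pred_image (vol \o uncurry G) (pair j) predT)//=; first last.
  - by move=> ? ? _ _; exact: (@can_inj _ _ _ snd).
  - by move=> n _; exact: (volG_ge0 (j, n)).
  by congr esum; rewrite predeqE => -[a b]; split; move=> [i _ <-]; exists i.
apply: lee_nneseries => n *; last exact: (PG n).2.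
by apply: nneseries_ge0 => k *; exact: (volG_ge0 (n, k)).
Qed.

HB.instance Definition _ := isOuterMeasure.Build R 'rV[R]_m.+1 mu
  lebesgue_outer0 lebesgue_outer_ge0 le_lebesgue_outer
  lebesgue_outer_sigma_subadditive.

End lebesgue_outer_measure_theory.

(* Lebesgue measure is the restriction of the outer measure to the
   Caratheodory-measurable sets. *)
Definition positive_lebesgue_measure {R : realType} {m : nat}
    (A : set 'rV[R]_m) : Prop :=
  (@lebesgue_outer R m).-caratheodory A /\ (0 < lebesgue_outer A)%E.

(* Main.v *)
Require Import Defs.
From HB Require Import structures.
From mathcomp Require Import all_boot all_order all_algebra.
From mathcomp Require Import all_classical all_reals all_analysis.
From mathcomp Require Import measurable_realfun.
From mathcomp Require Import ring lra.

Set Implicit Arguments.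
Unset Strict Implicit.
Unset Printing Implicit Defensive.

Import Order.TTheory GRing.Theory Num.Theory.
Import numFieldNormedType.Exports.

Local Open Scope classical_set_scope.
Local Open Scope ring_scope.

(** The function is [f x = `|phi (x 0 i)|] for a smooth [phi : R -> R] with
   bounded derivatives, so that [f] is Lipschitz and equals [phi] or [- phi].
   At a transversal zero of [phi] the function [f] has a kink, so it is enough
   that the transversal zeros accumulate at every point of a set of positive
   measure.  Take
     [phi t = \sum_n e_n * sin (N_n * t) * F (cos (N_n * t) - c_n)],
   where [F s = exp (- s^-1)] for [s > 0] and [F s = 0] for [s <= 0], the
   frequencies [N_n] divide one another and grow fast, [c_n] tends to 1, and
   [e_n] tends to 0 fast enough for termwise differentiation.  The points [t] of
   [[0, 2 pi]] where every [cos (N_n * t)] stays below a threshold smaller than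
   [c_n] form a set of positive measure.  Near such a [t] there is a [q] in
   [2 pi / N_n * nat]; the terms of index less than [n] vanish to first order
   at [q], while all the others vanish at [q] with a positive slope. *)

(** * Flat functions at the origin *)

Section flat_functions.
Context {R : realType}.
Implicit Types (f : R -> R) (p : {poly R}).

(** Dividing by [h] leaves an error of at most [B * |h|]. This one criterion serves twice: at the
    points where [flat] is glued to zero, and for differentiating a series term by term. *)
Lemma is_derive_quadratic f (x l B : R) :
  (forall h, `|f (x + h) - f x - h * l| <= B * h ^+ 2) -> is_derive x 1 f l.
Proof.
move=> fB.
have B0 : 0 <= B by have := fB 1; rewrite expr1n mulr1; exact: le_trans.
have cl : h^-1 *: (f (h *: 1 + x) - f x) @[h --> 0^'] --> l.
  apply/cvgrPdist_le => e e0; near=> h.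
  have h0 : h != 0 by near: h; exact: nbhs_dnbhs_neq.
  have -> : l - h^-1 *: (f (h *: 1 + x) - f x) =
      - (h^-1 * (f (x + h) - f x - h * l)).
    rewrite [h *: 1]mulr1 [h + x]addrC /GRing.scale/=.
    by move: (f (x + h)) (f x) => u v; field.
  rewrite normrN normrM normfV ler_pdivrMl ?normr_gt0//.
  rewrite (le_trans (fB h))// -real_normK ?num_real// expr2 mulrCA.
  rewrite ler_wpM2l// mulrC.
  apply: (@le_trans _ _ (`|h| * (B + 1))); first by rewrite ler_wpM2l// lerDl.
  rewrite -ler_pdivlMr ?ltr_wpDl//.
  by near: h; apply: dnbhs0_le; rewrite divr_gt0// ltr_wpDl.
by apply: DeriveDef; [exact: cvgP cl | exact: cvg_lim cl].
Unshelve. all: by end_near. Qed.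

(** The polynomial factor in [t^-1] makes the family closed under differentiation; [flat 1] is the
    function [F] of the overview. *)
Definition flat p : R -> R :=
  fun t => if 0 < t then p.[t^-1] * expR (- t^-1) else 0.

Lemma flat_le0 p t : t <= 0 -> flat p t = 0.
Proof. by rewrite /flat leNgt => /negbTE ->. Qed.

(** Each monomial is controlled by one term of the exponential series: [s ^+ n / n!] is below
    [expR s] for [s >= 0]. *)
Lemma horner_expRN_bounded p :
  exists2 C, 0 <= C & forall s, 0 <= s -> `|p.[s] * expR (- s)| <= C.
Proof.
have Xn n s : 0 <= s -> `|s ^+ n * expR (- s)| <= n`!%:R.
  move=> s0; rewrite ger0_norm ?mulr_ge0 ?exprn_ge0 ?expR_ge0//.
  rewrite expRN ler_pdivrMr ?expR_gt0//.
  case: n => [|n]; first by rewrite expr0 mul1r -expR0 ler_expR.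
  rewrite -ler_pdivrMl; last by rewrite ltr0n fact_gt0.
  rewrite mulrC (le_trans _ (expR_ge1Dxn n s0))//.
  by rewrite lerDr.
  exists (\sum_(i < size p) `|p`_i| * i`!%:R).
    by apply: sumr_ge0 => i _; rewrite mulr_ge0.
  move=> s s0; rewrite horner_coef mulr_suml.
  apply: le_trans (ler_norm_sum _ _ _) _; apply: ler_sum => i _.
  by rewrite -mulrA normrM ler_wpM2l// Xn.
Qed.

Lemma flat_bounded p : exists C, forall t, `|flat p t| <= C.
Proof.
have [C C0 pC] := horner_expRN_bounded p; exists C => t; rewrite /flat.
by case: ifPn => [t0|_]; rewrite ?normr0// pC// invr_ge0 ltW.
Qed.

(** Boundedness of the exponential against [p * 'X^2], read at [t^-1], gains the factor [t ^+ 2]. *)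
Lemma flat_quadratic p : exists2 C, 0 <= C & forall t, `|flat p t| <= C * t ^+ 2.
Proof.
have [C C0 pC] := horner_expRN_bounded (p * 'X^2); exists C => // t; rewrite /flat.
case: ifPn => [t0|_]; last by rewrite normr0 mulr_ge0// sqr_ge0.
have := pC t^-1; rewrite invr_ge0 (ltW t0) => /(_ isT).
rewrite hornerM hornerXn mulrAC normrM [X in _ * X]ger0_norm; last first.
  by rewrite exprn_ge0// invr_ge0 ltW.
by rewrite exprVn ler_pdivrMr// exprn_gt0.
Qed.

(** With [s = t^-1], the chain rule contributes [- s ^+ 2], and differentiating [p(s) * expR (- s)]
    in [s] gives [(p' - p)(s) * expR (- s)]. *)
Definition flat_derivative p : {poly R} := 'X^2 * (p - p^`()).

Lemma is_derive_flat p (t : R) : is_derive t 1 (flat p) (flat (flat_derivative p) t).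
Proof.
have [t0|t0] := leP t 0.
  (* Here the value and the expected slope are both 0. Only [0 < t + h] needs work, and then
     [t + h <= h] because [t <= 0]. *)
  have [C C0 pC] := flat_quadratic p.
  apply: (@is_derive_quadratic _ _ _ C) => h.
  rewrite !(flat_le0 _ t0) subr0 mulr0 subr0.
  have [th|th] := leP (t + h) 0.
    by rewrite flat_le0// normr0 mulr_ge0// sqr_ge0.
  rewrite (le_trans (pC _))// ler_wpM2l// lerXn2r ?nnegrE; lra.
have tN0 : t != 0 by rewrite gt_eqF.
pose g : R -> R := (horner p \o (fun y => (id y)^-1)) *
                   (expR \o -%R \o (fun y => (id y)^-1)).
have dV : is_derive t 1 (fun y : R => (id y)^-1) (- t ^- 2 *: 1).
  exact: is_deriveV.
have dg : is_derive t 1 g (flat (flat_derivative p) t).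
  apply: is_derive_eq.
  rewrite /flat t0 /flat_derivative !hornerE /= /GRing.scale /=.
  by field.
have gE : {near t, g =1 flat p}.
  near=> y; rewrite /g /flat.
  have -> : 0 < y by near: y; exact: lt_nbhsr.
  by [].
by apply: near_eq_is_derive gE _; rewrite ?oner_eq0.
Unshelve. all: by end_near. Qed.

End flat_functions.

(** * Smooth functions on the line with bounded derivatives *)

Section bounded_smooth_functions.
Context {R : realType}.
Implicit Types (f g : R -> R) (x : R).

Lemma MVT_two_sided f df x y : (forall z : R, is_derive z 1 f (df z)) ->
  exists2 c, `|c - x| <= `|y - x| & f y - f x = df c * (y - x).
Proof.
move=> fdf.
have fc a b : {within `[a, b], continuous f}.
  apply: continuous_subspaceT => z.
  by apply/differentiable_continuous/derivable1_diffP; exact: ex_derive.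
have [xy|/ltW yx] := leP x y.
  have [c cxy E] := MVT_segment xy (fun z _ => fdf z) (fc x y).
  exists c => //; rewrite !ger0_norm ?subr_ge0 ?(itvP cxy)//.
  by rewrite lerD2r (itvP cxy).
have [c cxy E] := MVT_segment yx (fun z _ => fdf z) (fc y x).
exists c; last by rewrite -opprB E -mulrN opprB.
rewrite ![`|_ - x|]distrC !ger0_norm ?subr_ge0 ?(itvP cxy)//.
by rewrite lerD2l lerN2 (itvP cxy).
Qed.

Lemma lipschitz_of_bounded_derive f df M x y :
  (forall z : R, is_derive z 1 f (df z)) -> (forall z, `|df z| <= M) ->
  `|f y - f x| <= M * `|y - x|.
Proof.
move=> /(MVT_two_sided x y)[c _ ->] dfM.
by rewrite normrM ler_wpM2r.
Qed.

(** Two uses of the mean value theorem, on [f] and then on [df]. The sharp constant [M / 2] is lost,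
    which is harmless for [is_derive_quadratic]. *)
Lemma taylor1_bound f df ddf M x h :
  (forall z : R, is_derive z 1 f (df z)) ->
  (forall z : R, is_derive z 1 df (ddf z)) -> (forall z, `|ddf z| <= M) ->
  `|f (x + h) - f x - h * df x| <= M * h ^+ 2.
Proof.
move=> /(MVT_two_sided x (x + h))[c + ->] fdd ddfM.
rewrite [x + h]addrC addrK => cx; rewrite mulrC -mulrBr normrM.
have M0 : 0 <= M := le_trans (normr_ge0 _) (ddfM 0).
rewrite -real_normK ?num_real// expr2 mulrCA ler_wpM2l//.
rewrite (le_trans (lipschitz_of_bounded_derive x c fdd ddfM))//.
by rewrite ler_wpM2l.
Qed.

(** The bounds travel with the derivatives because the coefficients of the series are later chosen
    from them. *)
Fixpoint bounded_Ck (k : nat) f : Prop :=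
  (exists C, forall x, `|f x| <= C) /\
  if k is k'.+1 then
    (forall x, derivable f x 1) /\ bounded_Ck k' (derive1 f)
  else True.

Definition bounded_smooth f := forall k, bounded_Ck k f.

Lemma bounded_CkS k f df : (exists C, forall x, `|f x| <= C) ->
  (forall x : R, is_derive x 1 f (df x)) -> bounded_Ck k df ->
  bounded_Ck k.+1 f.
Proof.
move=> fC fdf dfk; split=> //; split=> [x|]; first exact: ex_derive.
suff -> : derive1 f = df by [].
by apply/funext => x; rewrite derive1E; exact: derive_val.
Qed.

Lemma bounded_Ck_bounded k f : bounded_Ck k f -> exists C, forall x, `|f x| <= C.
Proof. by case: k => [|k] []. Qed.

Lemma bounded_CkW k f : bounded_Ck k.+1 f -> bounded_Ck k f.
Proof.
elim: k f => [|k IH] f [fC [fd fk]]; first by [].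
by split => //; split => //; exact: IH.
Qed.

Lemma bounded_CkD k f g : bounded_Ck k f -> bounded_Ck k g ->
  bounded_Ck k (f + g).
Proof.
elim: k f g => [|k IH] f g [[C fC] fk] [[D gD] gk].
  split=> //; exists (C + D) => x.
  by rewrite (le_trans (ler_normD _ _))// lerD.
case: fk => fd fk; case: gk => gd gk.
apply: (@bounded_CkS _ _ (derive1 f + derive1 g)) => [|x|].
- exists (C + D) => x.
  by rewrite (le_trans (ler_normD _ _))// lerD.
- apply: is_deriveD; rewrite derive1E; exact: derivableP.
- exact: IH.
Qed.

Lemma bounded_CkM k f g : bounded_Ck k f -> bounded_Ck k g ->
  bounded_Ck k (f * g).
Proof.
elim: k f g => [|k IH] f g fk gk.
  case: fk => [[C fC] _]; case: gk => [[D gD] _].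
  split=> //; exists (C * D) => x; rewrite normrM ler_pM//.
have [C fC] := bounded_Ck_bounded fk.
have [D gD] := bounded_Ck_bounded gk.
have fk' := bounded_CkW fk; have gk' := bounded_CkW gk.
case: fk => _ [fd fk]; case: gk => _ [gd gk].
apply: (@bounded_CkS _ _ (f * derive1 g + g * derive1 f)) => [|x|].
- by exists (C * D) => x; rewrite normrM ler_pM.
- apply: is_deriveM; rewrite derive1E; exact: derivableP.
- by apply: bounded_CkD; exact: IH.
Qed.

(** Combinations of sine and cosine of a fixed frequency are stable under differentiation, so the
    induction runs over all [a] and [b] at once. *)
Lemma bounded_smooth_trig (w a b : R) :
  bounded_smooth (fun x => a * sin (w * x) + b * cos (w * x)).
Proof.
have bd a' b' : exists C, forall x, `|a' * sin (w * x) + b' * cos (w * x)| <= C.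
  exists (`|a'| + `|b'|) => x; rewrite (le_trans (ler_normD _ _))// !normrM.
  by rewrite lerD// ler_piMr// ?sin_max ?cos_max.
move=> k; elim: k a b => [|k IH] a b; first by [].
apply: bounded_CkS (bd a b) _ (IH (- (b * w)) (a * w)) => x.
have dw : is_derive x 1 ( *%R w) w.
  apply: is_derive_eq (is_deriveZ w (is_derive_id x 1)) _.
  by rewrite /GRing.scale/= mulr1.
have -> : (fun x => a * sin (w * x) + b * cos (w * x)) =
    a *: (sin \o ( *%R w)) + b *: (cos \o ( *%R w)) by [].
by apply: is_derive_eq; rewrite /GRing.scale/=; ring.
Qed.

Lemma bounded_smooth_flat_comp g dg : (forall x, is_derive x 1 g (dg x)) ->
  bounded_smooth dg -> forall p, bounded_smooth (flat p \o g).
Proof.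
move=> gdg dgs p k; elim: k p => [|k IH] p.
  by split=> //; have [C pC] := flat_bounded p; exists C => x; exact: pC.
apply: (@bounded_CkS _ _ ((flat (flat_derivative p) \o g) * dg)).
- by have [C pC] := flat_bounded p; exists C => x; exact: pC.
- by move=> x; apply: is_derive1_comp; exact: is_derive_flat.
- exact: bounded_CkM.
Qed.

Lemma bounded_smooth_derive1n f n : bounded_smooth f -> bounded_smooth (derive1n n f).
Proof.
move=> fs; elim: n => [//|n IH] k.
by have [_ []] := IH k.+1; rewrite derive1nS.
Qed.

Lemma bounded_smooth_bounded f n : bounded_smooth f ->
  exists C, forall x, `|derive1n n f x| <= C.
Proof.
by move=> /(bounded_smooth_derive1n n)/(_ 0%N)/bounded_Ck_bounded.
Qed.

Lemma is_derive_bounded_smooth f n x : bounded_smooth f ->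
  is_derive x 1 (derive1n n f) (derive1n n.+1 f x).
Proof.
move=> /(bounded_smooth_derive1n n)/(_ 1%N)[_ [fd _]].
by rewrite derive1nS derive1E; exact: derivableP.
Qed.

End bounded_smooth_functions.

(** * Termwise differentiation of series *)

Section smooth_series.
Context {R : realType}.

Lemma dominated_series_cvg (v b : R^nat) : (forall n, `|v n| <= b n) ->
  cvgn (series b) -> cvgn (series v).
Proof.
move=> vb cb; apply: normed_cvg; apply: series_le_cvg cb => //= n.
by rewrite (le_trans _ (vb n)).

Qed.

Lemma dominated_series_bound (v b : R^nat) s : (forall n, `|v n| <= b n) ->
  cvgn (series b) -> series v @ \oo --> s -> `|s| <= limn (series b).
Proof.
move=> vb cb vs; apply: (ler_cvg_to (cvg_norm vs) cb); apply: nearW => n /=.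
by rewrite (le_trans (ler_norm_sum _ _ _))//; apply: ler_sum.
Qed.

(** The first-order Taylor remainders of the terms are at most [b n * h ^+ 2]. Summing them bounds
    the remainder of [s] quadratically in [h]. *)
Lemma is_derive_series (v dv ddv : nat -> R -> R) (b : R^nat) (s ds : R -> R) (x : R) :
  (forall n (z : R), is_derive z 1 (v n) (dv n z)) ->
  (forall n (z : R), is_derive z 1 (dv n) (ddv n z)) ->
  (forall n z, `|ddv n z| <= b n) -> cvgn (series b) ->
  (forall z, series (v ^~ z) @ \oo --> s z) ->
  (forall z, series (dv ^~ z) @ \oo --> ds z) ->
  is_derive x 1 s (ds x).
Proof.
move=> dv_ ddv_ ddvb cb vs dvs.
apply: (@is_derive_quadratic _ _ _ _ (limn (series b))) => h.
pose r n := v n (x + h) - v n x - h * dv n x.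
have rs : series r @ \oo --> s (x + h) - s x - h * ds x.
  have -> : series r = series (v ^~ (x + h)) - series (v ^~ x) - h *: series (dv ^~ x).
    apply/funext => n; rewrite /series/= /r !fctE/=.
    by rewrite !sumrB /GRing.scale/= mulr_sumr.
  apply: cvgB; first exact: cvgB.
  exact: cvgZl_tmp.
have cbh : series (fun n => b n * h ^+ 2) @ \oo --> limn (series b) * h ^+ 2.
  have -> : series (fun n => b n * h ^+ 2) = (fun n => series b n * h ^+ 2).
    by apply/funext => n; rewrite /series/= mulr_suml.
  exact: cvgMr_tmp.
rewrite -(cvg_lim _ cbh)//; apply: dominated_series_bound (cvgP _ cbh) rs => n.
exact: (taylor1_bound _ _ (dv_ n) (ddv_ n)).
Qed.

(** A diagonal choice: [e n] tames the derivatives of [u n] of order at most [n]. For a fixed order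
    [k] this leaves out only the finitely many [n < k]. *)
Lemma smooth_series_exists (u : nat -> R -> R) :
  (forall n, bounded_smooth (u n)) ->
  exists (e : nat -> R) (S : nat -> R -> R),
  [/\ forall n, 0 < e n,
      forall k (x : R), is_derive x 1 (S k) (S k.+1 x),
      forall k, exists C, forall x, `|S k x| <= C &
      forall k x, series (fun n => e n * derive1n k (u n) x) @ \oo --> S k x].
Proof.
move=> us.
have [C uC] : {C : nat * nat -> R &
    forall nk x, `|derive1n nk.2 (u nk.1) x| <= C nk}.
  apply: (@choice _ _ (fun nk c => forall x, `|derive1n nk.2 (u nk.1) x| <= c)) => nk.
  exact: bounded_smooth_bounded.
have C0 nk : 0 <= C nk := le_trans (normr_ge0 _) (uC nk 0).
pose T n := 1 + \sum_(k < n.+1) C (n, val k).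
have T1 n : 1 <= T n by rewrite lerDl sumr_ge0.
have T0 n : 0 < T n := lt_le_trans ltr01 (T1 n).
pose e n := 2^-1 ^+ n / T n.
have e0 n : 0 < e n by rewrite divr_gt0// exprn_gt0// invr_gt0.
have e_le n : e n <= 2^-1 ^+ n.
  by rewrite ler_pdivrMr// ler_peMr// exprn_ge0// invr_ge0.
(* [D k] absorbs the terms of index [n < k], for which [T n] does not control the derivative of
   order [k]. *)
pose D k := 1 + \sum_(n < k) C (val n, k).
have b_ge0 k n : 0 <= geometric (D k) 2^-1 n.
  rewrite mulr_ge0 ?exprn_ge0 ?invr_ge0//.
  by rewrite ltW// (@lt_le_trans _ _ 1)// lerDl sumr_ge0.
have eb k n x : `|e n * derive1n k (u n) x| <= geometric (D k) 2^-1 n.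
  rewrite normrM gtr0_norm// /=.
  apply: (@le_trans _ _ (e n * C (n, k))).
    by apply: ler_wpM2l; [exact: ltW|exact: (uC (n, k))].
  have [nk|kn] := ltnP n k.
    rewrite mulrC; apply: ler_pM => //; first exact: ltW.
    rewrite /D (bigD1 (Ordinal nk))//=.
    by rewrite addrCA lerDl addr_ge0// sumr_ge0.
  apply: (@le_trans _ _ (2^-1 ^+ n)); last first.
    by rewrite ler_peMl ?exprn_ge0 ?invr_ge0// lerDl sumr_ge0.
  rewrite /e mulrAC ler_pdivrMr// ler_wpM2l ?exprn_ge0 ?invr_ge0//.
  have kn1 : (k < n.+1)%N by [].
  by rewrite /T (bigD1 (Ordinal kn1))//= addrCA lerDl addr_ge0// sumr_ge0.
have cb k : cvgn (series (geometric (D k) 2^-1)).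
  by apply: is_cvg_geometric_series; rewrite ger0_norm ?invr_ge0// invf_lt1// ltr1n.
pose S k x := limn (series (fun n => e n * derive1n k (u n) x)).
have eS k x : series (fun n => e n * derive1n k (u n) x) @ \oo --> S k x.
  by apply: dominated_series_cvg (cb k) => n; exact: eb.
exists e, S; split => //.
- move=> k x.
  have de j n (z : R) :
      is_derive z 1 (e n *: derive1n j (u n)) (e n * derive1n j.+1 (u n) z).
    by apply: is_deriveZ; exact: is_derive_bounded_smooth.
  exact: (is_derive_series x (de k) (de k.+1) (eb k.+2) (cb k.+2) (eS k) (eS k.+1)).
- move=> k; exists (limn (series (geometric (D k) 2^-1))) => x.
  by apply: dominated_series_bound (cb k) (eS k x) => n; exact: eb.
Qed.

End smooth_series.

(** * Outer measure and measurability of cylinders over a coordinate *)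

Section lebesgue_outer_cylinders.
Local Open Scope ereal_scope.
Context {R : realType}.
Local Notation lambda := (@lebesgue_measure R).

Lemma lebesgue_measure_ocitv (a b : R) : (a <= b)%R ->
  lambda `]a, b] = (b - a)%:E.
Proof.
move=> ab; rewrite lebesgue_measure_itv/= lte_fin.
case: ltP => [_|ba]; first by rewrite EFinB.
by have -> : a = b by [apply: le_anti; rewrite ab ba]; rewrite subrr.
Qed.

(* Tonelli for step functions: one coordinate is integrated out at a time,
   its indicator being absorbed into the weights [w]. *)
Lemma weighted_box_cover (D : set (measurableTypeR R)) (l c : R)
    (n : nat) (a b : nat -> nat -> R) (w : nat -> R) :
  measurable D -> (0 <= l)%R -> l%:E <= lambda D -> (0 <= c)%R ->
  (forall k i, (a k i <= b k i)%R) -> (forall k, (0 <= w k)%R) ->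
  (forall x : nat -> R, (forall i, (i < n)%N -> D (x i)) ->
    c%:E <= \sum_(k <oo) (w k * \prod_(i < n) \1_(`]a k i, b k i]) (x i))%:E) ->
  (c * l ^+ n)%:E <= \sum_(k <oo) (w k * \prod_(i < n) (b k i - a k i))%:E.
Proof.
move=> mD l0 lD c0 ab; elim: n w => [|n IH] w w0 cover.
  rewrite expr0 mulr1; have := cover (fun=> 0%R) (fun _ => ltac:(by [])).
  under eq_eseriesr do rewrite big_ord0.
  by under [X in _ -> _ <= X]eq_eseriesr do rewrite big_ord0.
pose V k : R := (\prod_(i < n) (b k i - a k i))%R.
have V0 k : (0 <= V k)%R by apply: prodr_ge0 => i _; rewrite subr_ge0.
pose F k : measurableTypeR R -> \bar R :=
  fun t => (w k * V k)%:E * (\1_(`]a k n, b k n]) t)%:E.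
have mF k : measurable_fun D (F k).
  apply: measurable_funeM; apply/measurable_EFinP.
  exact: measurable_indic.
have F0 k t : 0 <= F k t.
  by rewrite /F -EFinM lee_fin !mulr_ge0// ?indicE.
have FD t : D t -> (c * l ^+ n)%:E <= \sum_(k <oo) F k t.
  move=> Dt.
  have -> : \sum_(k <oo) F k t =
      \sum_(k <oo) ((w k * \1_(`]a k n, b k n]) t) * V k)%:E.
    by apply: eq_eseriesr => k _; rewrite /F -EFinM mulrAC.
  apply: IH => [k|x xD]; first by rewrite mulr_ge0// indicE.
  have := cover (fun i => if i == n then t else x i).
  move=> /(_ _)/le_trans; apply.
    by move=> i; rewrite ltnS leq_eqVlt; case: eqP => //= _ /xD.
  rewrite le_eqVlt; apply/orP; left; apply/eqP.
  apply: eq_eseriesr => k _; rewrite big_ord_recr/= eqxx mulrA mulrAC.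
  congr (_ * _ * _)%:E; apply: eq_bigr => i _.
  by rewrite (ltn_eqF (ltn_ord i)).
have -> : (c * l ^+ n.+1)%:E = (c * l ^+ n)%:E * l%:E.
  by rewrite -EFinM exprSr mulrA.
(* Integrating the bound [FD] over [D] produces the extra factor [l]. On the other side,
   intersecting an interval with [D] can only decrease its length. *)
apply: (@le_trans _ _ (\int[lambda]_(t in D) (cst (c * l ^+ n)%:E) t)).
  by rewrite integral_cst// lee_wpmul2l// lee_fin mulr_ge0// exprn_ge0.
apply: (@le_trans _ _ (\int[lambda]_(t in D) \sum_(k <oo) F k t)).
  apply: ge0_le_integral => //.
  - by move=> t _; rewrite lee_fin mulr_ge0// exprn_ge0.
  - have -> : (fun t => \sum_(k <oo) F k t) =
      (fun t => \sum_(k <oo | k \in xpredT) F k t) by [].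
    exact: ge0_emeasurable_sum.
rewrite integral_nneseries//.
apply: lee_nneseries => [k _ _|k _]; first by apply: integral_ge0 => t _.
rewrite /F ge0_integralZl_EFin ?mulr_ge0//; last first.
  by apply/measurable_EFinP; exact: measurable_indic.
rewrite integral_indic// big_ord_recr/= mulrA [leRHS]EFinM.
rewrite lee_wpmul2l ?lee_fin ?mulr_ge0//.
rewrite -lebesgue_measure_ocitv//.
by apply: le_measure; rewrite ?inE//; exact: measurableI.
Qed.

Context {m : nat}.
Local Notation mu := (@lebesgue_outer R m.+1).

(** The cylinder contains the product of [m.+1] copies of [D], and any cover by boxes is tested on
    that product only. *)
Lemma lebesgue_outer_cylinder_ge (D : set R) (l : R) (i : 'I_m.+1) :
  measurable D -> (0 <= l)%R -> l%:E <= lambda D ->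
  (l ^+ m.+1)%:E <= mu [set x : 'rV[R]_m.+1 | D (x 0%R i)].
Proof.
move=> mD l0 lD; apply: le_ereal_inf_tmp => _ [I [I_le DI] <-].
pose a k j : R := (I k).1 0%R (inord j).
pose b k j : R := (I k).2 0%R (inord j).
have ab k j : (a k j <= b k j)%R by exact: I_le.
have term_ge0 (x : nat -> R) k :
    0 <= (1 * \prod_(j < m.+1) \1_(`]a k j, b k j]) (x j) : R)%:E.
  by rewrite lee_fin mul1r; apply: prodr_ge0 => j _; rewrite indicE.
have := @weighted_box_cover D l 1 m.+1 a b (fun=> 1%R) mD l0 lD ler01 ab (fun=> ler01).
rewrite mul1r => /(_ _)/le_trans; apply.
  move=> x xD.
  have /DI[k _ Ikx] : [set x : 'rV[R]_m.+1 | D (x 0%R i)] (\row_(j < m.+1) x j).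
    by rewrite /= mxE; exact: xD.
  apply: (@le_trans _ _ (1 * \prod_(j < m.+1) \1_(`]a k j, b k j]) (x j))%:E).
    rewrite mul1r big1// => j _; rewrite indicE mem_set//=.
    by have := Ikx j; rewrite mxE /a /b inord_val in_itv.
  rewrite (@nneseriesD1 _ _ k xpredT) => [|j _|//]; last exact: term_ge0.
  by rewrite leeDl// nneseries_ge0// => j _ _; exact: term_ge0.
rewrite le_eqVlt; apply/orP; left; apply/eqP; apply: eq_eseriesr => k _.
rewrite mul1r /box_volume; congr _%:E; apply: eq_bigr => j _.
by rewrite /a /b inord_val.
Qed.

Definition set_coord (x : 'rV[R]_m.+1) (i : 'I_m.+1) (d : R) : 'rV[R]_m.+1 :=
  \row_j (if j == i then d else x 0%R j).

Lemma box_volume_split (a b : 'rV[R]_m.+1) (i : 'I_m.+1) (d : R) :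
  box_volume a (set_coord b i d) + box_volume (set_coord a i d) b = box_volume a b.
Proof.
rewrite /box_volume -EFinD; congr _%:E.
have bigD1i (F : 'I_m.+1 -> R) :
    (\prod_j F j = F i * \prod_(j | j != i) F j)%R by rewrite (bigD1 i).
rewrite !bigD1i !mxE eqxx.
under eq_bigr => j ji do rewrite mxE (negbTE ji).
under [X in (_ + _ * X)%R]eq_bigr => j ji do rewrite mxE (negbTE ji).
by rewrite -mulrDl; congr (_ * _)%R; rewrite addrC subrKA.
Qed.

(** The hyperplane cuts every box of a cover into two boxes of the same total volume, one family
    covering each side. *)
Lemma caratheodory_halfspace (i : 'I_m.+1) (c : R) :
  mu.-caratheodory [set x : 'rV[R]_m.+1 | (x 0 i <= c)%R].
Proof.
set H := [set x | _]; apply: le_caratheodory_measurable => X.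
apply: le_ereal_inf_tmp => _ [I [I_le XI] <-].
(* The cut [c] is clamped to the side of the box, so a box missed by the hyperplane splits into
   itself and a degenerate box. *)
pose d k := Num.max ((I k).1 0%R i) (Num.min ((I k).2 0%R i) c).
pose I1 k := ((I k).1, set_coord (I k).2 i (d k)).
pose I2 k := (set_coord (I k).1 i (d k), (I k).2).
have I1_le k j : ((I1 k).1 0 j <= (I1 k).2 0 j)%R.
  by rewrite mxE; case: eqP => [->|_]; [rewrite le_max lexx|exact: I_le].
have I2_le k j : ((I2 k).1 0 j <= (I2 k).2 0 j)%R.
  rewrite mxE; case: eqP => [->|_]; last exact: I_le.
  by rewrite ge_max I_le ge_min lexx.
have vol_ge0 (J : nat -> 'rV[R]_m.+1 * 'rV[R]_m.+1) :
    (forall k j, ((J k).1 0 j <= (J k).2 0 j)%R) ->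
    forall k, 0 <= box_volume (J k).1 (J k).2.
  move=> Jle k; rewrite lee_fin; apply: prodr_ge0 => j _.
  by rewrite subr_ge0.
have XI1 : box_cover (X `&` H) I1.
  split=> // x [/XI[k _ Ikx] xc]; exists k => // j.
  have /andP[xa xb] := Ikx j; rewrite xa/= mxE; case: eqP => [ji|//].
  by rewrite /d le_max le_min -ji xb ji xc orbT.
have XI2 : box_cover (X `&` ~` H) I2.
  split=> // x [/XI[k _ Ikx] /negP]; rewrite -ltNge => cx; exists k => // j.
  have /andP[xa xb] := Ikx j; rewrite xb andbT mxE; case: eqP => [ji|//].
  by rewrite /d gt_max gt_min -ji xa ji cx orbT.
have -> : \sum_(k <oo) box_volume (I k).1 (I k).2 =
    \sum_(k <oo) box_volume (I1 k).1 (I1 k).2 +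
    \sum_(k <oo) box_volume (I2 k).1 (I2 k).2.
  rewrite -nneseriesD; last 2 first.
  - by move=> k _ _; exact: vol_ge0.
  - by move=> k _ _; exact: vol_ge0.
  by apply: eq_eseriesr => k _; rewrite box_volume_split.
by apply: leeD; apply: ereal_inf_lbound; [exists I1|exists I2].
Qed.

(** The bases of Caratheodory-measurable cylinders form a sigma-algebra. It contains the open rays
    to the right, which generate the measurable sets of the line. *)
Lemma caratheodory_cylinder (i : 'I_m.+1) (D : set R) : measurable D ->
  mu.-caratheodory [set x : 'rV[R]_m.+1 | D (x 0%R i)].
Proof.
pose C := [set B : set R | mu.-caratheodory [set x : 'rV[R]_m.+1 | B (x 0%R i)]].
suff : (@measurable _ R) `<=` C by apply.
rewrite [X in X `<=` _](RGenOInfty.measurableE R); apply: smallest_sub.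
  split.
  - exact: (@caratheodory_measurable_set0 _ _ (mu : {outer_measure set _ -> \bar R})).
  - move=> A CA; rewrite setTD.
    exact: (@caratheodory_measurable_setC _ _ (mu : {outer_measure set _ -> \bar R})).
  - move=> A CA.
    rewrite /C/=.
    have -> : [set x : 'rV[R]_m.+1 | (\bigcup_k A k) (x 0%R i)] =
      \bigcup_k [set x : 'rV[R]_m.+1 | A k (x 0%R i)] by [].
    exact: (@caratheodory_measurable_bigcup _ _ (mu : {outer_measure set _ -> \bar R})).
move=> _ [c ->]; rewrite /C/=.
have -> : [set x : 'rV[R]_m.+1 | (x 0%R i \in `]c, +oo[)%R] =
    ~` [set x | (x 0%R i <= c)%R].
  by apply/seteqP; split => x /=; rewrite in_itv/= andbT ltNge => /negP.
exact: (@caratheodory_measurable_setC _ _ (mu : {outer_measure set _ -> \bar R})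
  _ (@caratheodory_halfspace i c)).
Qed.

End lebesgue_outer_cylinders.

(** * The fat set and the oscillating bumps *)

Section fat_set.
Context {R : realType}.
Local Notation lambda := (@lebesgue_measure R).

(** Half-width, as an angle, of the arcs removed at level [n]. The divisor 4 makes the measure
    removed at level [n] at most [2^-1 ^+ n], hence at most 2 in all. *)
Definition gap (n : nat) : R := 2^-1 ^+ n / 4.

(** On the fat set the cosine of level [n] is at most [1 - depth n], while the bump starts above
    [1 - depth n / 2]. The margin [depth n / 2] allows a point to be moved. *)
Definition depth n : R := 1 - cos (gap n).

(* The factor [4 pi / depth n] makes the period at level [n + 1] too short for
   [cos (freq n * t)] to move by more than [depth n / 2] within one period. *)
Definition freq n : nat := (\prod_(i < n) (Num.trunc (4 * pi / depth i)).+1)%N.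

Definition bump n (t : R) : R :=
  sin ((freq n)%:R * t) * flat 1 (cos ((freq n)%:R * t) - (1 - depth n / 2)).

Definition fat_set : set R :=
  `[0, pi *+ 2] `&` [set t | forall n, cos ((freq n)%:R * t) <= cos (gap n)].

Lemma gap_gt0 n : 0 < gap n.
Proof. by rewrite divr_gt0// exprn_gt0// invr_gt0. Qed.

Lemma gap_le1 n : gap n <= 1.
Proof.
rewrite ler_pdivrMr// mul1r (@le_trans _ _ 1)// ?ler1n//.
by rewrite exprn_ile1 ?invr_ge0// invf_le1// ler1n.
Qed.

Lemma gap_pi n : gap n \in `[0, pi]%R.
Proof.
rewrite in_itv/= ltW ?gap_gt0//=.
by have := gap_le1 n; have := pi_ge2 R; lra.
Qed.

Lemma depth_gt0 n : 0 < depth n.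
Proof.
rewrite subr_gt0 -[ltRHS]cos0 ltr_cos ?gap_pi ?gap_gt0//.
by rewrite in_itv/= lexx pi_ge0.
Qed.

Lemma depth_le2 n : depth n <= 2.
Proof. by rewrite /depth; have := cos_geN1 (gap n); lra. Qed.

Lemma freq_step n : 4 * pi / depth n < (Num.trunc (4 * pi / depth n)).+1%:R.
Proof. exact: truncnS_gt. Qed.

Lemma freq_gt0 n : (0 < freq n)%N.
Proof. by apply: prodn_gt0. Qed.

Lemma freqR_gt0 n : 0 < (freq n)%:R :> R.
Proof. by rewrite ltr0n freq_gt0. Qed.

Lemma freqS n : freq n.+1 = (freq n * (Num.trunc (4 * pi / depth n)).+1)%N.
Proof. by rewrite /freq big_ord_recr. Qed.

Lemma freq_dvd i j : (i <= j)%N -> (freq i %| freq j)%N.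
Proof.
move=> /subnK <-; elim: (j - i)%N => [//|k IH].
by rewrite addSn freqS dvdn_mulr.
Qed.

Lemma freq_ratio i j : (i < j)%N ->
  (freq i)%:R * (4 * pi) <= (freq j)%:R * depth i :> R.
Proof.
move=> ij; have := dvdn_leq (freq_gt0 j) (freq_dvd ij).
rewrite freqS -(ler_nat R) natrM => le_ij.
rewrite -ler_pdivrMr ?depth_gt0// (le_trans _ le_ij)//.
rewrite -[leLHS]mulrA ler_wpM2l//.
exact/ltW/freq_step.
Qed.

(** Each factor of the product is at least 2, so [freq n] is at least [2 ^ n]; the lattice meshes
    thus tend to 0. *)
Lemma freq_gt n : (n < freq n)%N.
Proof.
apply: (leq_trans (ltn_expl n (ltnSn 1))).
elim: n => [|n IH]; first by rewrite /freq big_ord0.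
rewrite expnSr freqS leq_mul// -(ltr_nat R) (le_lt_trans _ (freq_step n))//.
rewrite ler_pdivlMr ?depth_gt0//.
by have := depth_le2 n; have := pi_ge2 R; lra.
Qed.

Lemma cos_lipschitz (x y : R) : `|cos y - cos x| <= `|y - x|.
Proof.
rewrite -[leRHS]mul1r.
apply: (lipschitz_of_bounded_derive _ _ (@is_derive_cos R)) => z.
by rewrite normrN sin_max.
Qed.

Lemma cos_nat2pi (x : R) k : cos (x + 2 * pi * k%:R) = cos x.
Proof.
by rewrite mulr_natr [2 * pi]mulr_natl (periodicn (@cosD2pi R)).
Qed.

Lemma sin_nat2pi (x : R) k : sin (x + 2 * pi * k%:R) = sin x.
Proof.
by rewrite mulr_natr [2 * pi]mulr_natl (periodicn (@sinD2pi R)).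
Qed.

Lemma bounded_smooth_bump n : bounded_smooth (bump n).
Proof.
pose w : R := (freq n)%:R.
have -> : bump n = (fun t => 1 * sin (w * t) + 0 * cos (w * t)) *
    (flat 1 \o (fun t => cos (w * t) - (1 - depth n / 2))).
  by apply/funext => t; rewrite /bump fctE/= mul1r mul0r addr0.
move=> k; apply: bounded_CkM; first exact: bounded_smooth_trig.
apply: (@bounded_smooth_flat_comp _ _
  (fun t => (- w) * sin (w * t) + 0 * cos (w * t))) => [t|].
  have dw : is_derive t 1 ( *%R w) w.
    apply: is_derive_eq (is_deriveZ w (is_derive_id t 1)) _.
    by rewrite /GRing.scale/= mulr1.
  have -> : (fun t => cos (w * t) - (1 - depth n / 2)) =
    (cos \o ( *%R w)) - cst (1 - depth n / 2) by [].
  by apply: is_derive_eq; ring.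
exact: bounded_smooth_trig.
Qed.

Lemma derive_bump n t : derive1n 1 (bump n) t =
  (freq n)%:R *
    (cos ((freq n)%:R * t) * flat 1 (cos ((freq n)%:R * t) - (1 - depth n / 2)) -
     sin ((freq n)%:R * t) ^+ 2 *
       flat (flat_derivative 1) (cos ((freq n)%:R * t) - (1 - depth n / 2))).
Proof.
pose w : R := (freq n)%:R.
have -> : bump n = (sin \o ( *%R w)) *
    (flat 1 \o ((cos \o ( *%R w)) - cst (1 - depth n / 2))) by [].
have dw : is_derive t 1 ( *%R w) w.
  apply: is_derive_eq (is_deriveZ w (is_derive_id t 1)) _.
  by rewrite /GRing.scale/= mulr1.
have df := is_derive_flat (1 : {poly R}).
rewrite derive1n1 derive1E; apply: derive_val.
apply: is_derive_eq; rewrite /GRing.scale/= /w.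
by ring.
Qed.

Lemma bump_inactive n t : cos ((freq n)%:R * t) <= 1 - depth n / 2 ->
  bump n t = 0 /\ derive1n 1 (bump n) t = 0.
Proof.
move=> ct; rewrite derive_bump /bump !flat_le0 ?subr_le0//.
by rewrite !mulr0 subr0 mulr0.
Qed.

Lemma bump_transversal n t :
  sin ((freq n)%:R * t) = 0 -> cos ((freq n)%:R * t) = 1 ->
  bump n t = 0 /\ 0 < derive1n 1 (bump n) t.
Proof.
move=> st ct; rewrite derive_bump /bump st ct mul0r; split => //.
rewrite expr0n/= mul0r subr0 mul1r mulr_gt0 ?freqR_gt0//.
have d0 := depth_gt0 n.
rewrite /flat; have -> : 0 < 1 - (1 - depth n / 2) :> R by lra.
by rewrite hornerC mul1r expR_gt0.
Qed.

(** By divisibility of the frequencies, a lattice point of level [n] belongs to the lattice of every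
    later level, where the bump crosses zero upwards. The earlier bumps are inactive there. *)
Lemma bump_grid n k t : (freq n)%:R * t = 2 * pi * k%:R :> R ->
  (forall j, (j < n)%N -> cos ((freq j)%:R * t) <= 1 - depth j / 2) ->
  [/\ forall j, bump j t = 0, forall j, 0 <= derive1n 1 (bump j) t
    & 0 < derive1n 1 (bump n) t].
Proof.
move=> tE inact.
have high j : (n <= j)%N -> bump j t = 0 /\ 0 < derive1n 1 (bump j) t.
  move=> /freq_dvd/dvdnP[q qE].
  have jE : (freq j)%:R * t = 0 + 2 * pi * (q * k)%:R :> R.
    by rewrite qE natrM -mulrA tE natrM add0r; ring.
  by apply: bump_transversal; rewrite jE ?sin_nat2pi ?cos_nat2pi ?sin0 ?cos0.
split=> [j|j|].
- by have [/high[]|/inact/bump_inactive[]] := leqP n j.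
- have [/high[_ /ltW//]|/inact/bump_inactive[_ ->//]] := leqP n j.
- by have [] := high n (leqnn n).
Qed.

(* The lattice [2 pi / freq n * nat] has mesh [2 pi / freq n], and moving [t] by
   at most that much keeps the lower levels inactive. *)
Lemma fat_set_grid t n : fat_set t -> exists k (q : R),
  [/\ (freq n)%:R * q = 2 * pi * k%:R,
       `|t - q| * (freq n)%:R <= 2 * pi &
       forall j, (j < n)%N -> cos ((freq j)%:R * q) <= 1 - depth j / 2].
Proof.
move=> [/= t02 tfat]; have /andP[t0 _] : 0 <= t <= pi *+ 2 by rewrite in_itv in t02.
have pi0 := pi_gt0 R; have N0 := freqR_gt0 n.
set N : R := (freq n)%:R in N0 *.
pose y := N * t / (2 * pi).
have y0 : 0 <= y by rewrite divr_ge0 ?mulr_ge0// ltW.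
exists (Num.trunc y), (2 * pi * (Num.trunc y)%:R / N).
have qN : N * (2 * pi * (Num.trunc y)%:R / N) = 2 * pi * (Num.trunc y)%:R.
  by rewrite mulrC divfK// gt_eqF.
set q := _ / N in qN *.
have dist : `|t - q| * N <= 2 * pi.
  rewrite -[X in _ * X]gtr0_norm// -normrM mulrBl ![_ * N]mulrC qN.
  have -> : N * t = 2 * pi * y by rewrite [RHS]mulrC divfK// gt_eqF// mulr_gt0.
  rewrite -mulrBr normrM gtr0_norm ?mulr_gt0// ler_piMr ?mulr_ge0 ?pi_ge0//.
  have /andP[y1 y2] := truncn_itv y0.
  rewrite ger0_norm ?subr_ge0//.
  by rewrite lerBlDl -natr1 in y2 *; exact: ltW.
split=> // j jn.
have := tfat j; have := cos_lipschitz ((freq j)%:R * t) ((freq j)%:R * q).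
rewrite -mulrBr normrM [`|(freq j)%:R|]ger0_norm// [`|q - t|]distrC => lip ct.
have : (freq j)%:R * `|t - q| <= depth j / 2.
  rewrite -(ler_pM2r N0) -mulrA.
  apply: (@le_trans _ _ ((freq j)%:R * (2 * pi))); first by rewrite ler_wpM2l.
  by have := freq_ratio jn; rewrite -/N; lra.
have := le_trans (ler_norm _) lip; rewrite /depth in ct *.
lra.
Qed.

Lemma closed_cos_sublevel n :
  closed [set t : R | cos ((freq n)%:R * t) <= cos (gap n)].
Proof.
have -> : [set t : R | cos ((freq n)%:R * t) <= cos (gap n)] =
    (fun t => cos ((freq n)%:R * t)) @^-1` [set y | y <= cos (gap n)] by [].
apply: closed_comp; last exact: closed_le.
move=> t _; apply: continuous_comp; last exact: continuous_cos.
exact: mulrl_continuous.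
Qed.

Lemma measurable_fat_set : measurable fat_set.
Proof.
have -> : fat_set = `[0, pi *+ 2] `&`
    \bigcap_n [set t : R | cos ((freq n)%:R * t) <= cos (gap n)].
  by apply/seteqP; split=> t [t02 tfat]; split=> // n; have := tfat n; exact.
apply: measurableI => //; apply: bigcapT_measurable => n.
by apply: closed_measurable; exact: closed_cos_sublevel.
Qed.

Lemma cos_superlevel n (t : R) : 0 <= t <= pi *+ 2 ->
  cos (gap n) < cos ((freq n)%:R * t) ->
  exists2 k, (k < (freq n).+1)%N &
    ball (2 * pi * k%:R / (freq n)%:R) (gap n / (freq n)%:R) t.
Proof.
move=> /andP[t0 t2] ct; have N0 := freqR_gt0 n; have pi0 := pi_gt0 R.
set N : R := (freq n)%:R in ct N0 *.
(* The shift by [2^-1] turns truncation into rounding, so [k] indexes a nearest lattice point and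
   the remaining angle lies within [pi]. *)
pose y := N * t / (2 * pi) + 2^-1.
have yE : N * t = 2 * pi * (y - 2^-1).
  by rewrite /y addrK [RHS]mulrC divfK// gt_eqF// mulr_gt0.
have y0 : 0 <= y by rewrite addr_ge0// divr_ge0 ?mulr_ge0// ltW.
have /andP[y1 y2] := truncn_itv y0; rewrite -natr1 in y2.
set k := Num.trunc y in y1 y2 *.
have kE : N * t = (N * t - 2 * pi * k%:R) + 2 * pi * k%:R by rewrite subrK.
exists k.
  rewrite ltnS /k truncn_le_nat -/N -natr1 -/N /y.
  have : N * t / (2 * pi) <= N.
    by rewrite ler_pdivrMr ?mulr_gt0// ler_wpM2l ?(ltW N0)// mulr_natl.
  by lra.
move: ct; rewrite kE cos_nat2pi -[cos (_ - _)]cos_norm ltr_cos ?gap_pi//; last first.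
  rewrite in_itv/= normr_ge0/= yE -mulrBr normrM gtr0_norm ?mulr_gt0//.
  have : `|y - 2^-1 - k%:R| <= 2^-1 by rewrite ler_norml; apply/andP; split; lra.
  rewrite -(ler_pM2l (mulr_gt0 (ltr0Sn R 1) pi0)) => /le_trans; apply.
  by rewrite mulrAC mulfV ?mul1r// pnatr_eq0.
move=> tk; rewrite -ball_normE/= distrC ltr_pdivlMr//.
rewrite -[X in _ * X]gtr0_norm// -normrM mulrBl divfK ?gt_eqF//.
by rewrite [t * N]mulrC.
Qed.

Definition superlevel n : set (measurableTypeR R) :=
  `[0, pi *+ 2] `\` [set t | cos ((freq n)%:R * t) <= cos (gap n)].

Lemma measurable_superlevel n : measurable (superlevel n).
Proof.
apply: measurableD => //.
by apply: closed_measurable; exact: closed_cos_sublevel.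
Qed.

(** There are [freq n + 1] balls of length [2 * gap n / freq n], both endpoints of the period
    interval being lattice points; the ratio [(N + 1) / N] costs a factor of at most 2. *)
Lemma superlevel_measure n : (lambda (superlevel n) <= (4 * gap n)%:E)%E.
Proof.
set N : R := (freq n)%:R; have N0 : 0 < N := freqR_gt0 n.
have N1 : 1 <= N by rewrite ler1n freq_gt0.
pose B k : set (measurableTypeR R) := ball (2 * pi * k%:R / N) (gap n / N).
apply: (@le_trans _ _ (\sum_(k < (freq n).+1) lambda (B k))%E).
  apply: content_subadditive.
  - by move=> k _; exact: measurable_ball.
  - exact: measurable_superlevel.
  - move=> t [/=]; rewrite in_itv/= => t02 /negP; rewrite -ltNge => ct.
    have [k kN tk] := cos_superlevel t02 ct.
    by rewrite -bigcup_mkord; exists k.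
rewrite (eq_bigr (fun=> ((gap n / N) *+ 2)%:E)); last first.
  by move=> k _; rewrite lebesgue_measure_ball// divr_ge0 ?ltW ?gap_gt0.
rewrite sumEFin lee_fin sumr_const card_ord -[leLHS]mulr_natr -[(freq n).+1%:R]natr1 -/N.
have g0 := gap_gt0 n.
have -> : gap n / N *+ 2 * (N + 1) = gap n * 2 * ((N + 1) / N).
  by rewrite -mulr_natr; field; rewrite gt_eqF.
have N2 : (N + 1) / N <= 2.
  by rewrite ler_pdivrMr// mulr_natl mulr2n lerD2l.
have -> : 4 * gap n = gap n * 2 * 2 :> R by ring.
by apply: ler_wpM2l => //; rewrite mulr_ge0// ltW.
Qed.

(** The interval has length [2 * pi], at least 4, and the superlevel sets remove at most 2. *)
Lemma fat_set_measure : (1%:E <= lambda fat_set)%E.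
Proof.
have mB := measurable_superlevel.
have gap4 n : 4 * gap n = geometric 1 2^-1 n.
  by rewrite /gap /= mul1r mulrC divfK// pnatr_eq0.
have sumB : (lambda (\bigcup_n superlevel n) <= 2%:E)%E.
  apply: (@le_trans _ _ (\sum_(n <oo) lambda (superlevel n))%E).
    by apply: measure_sigma_subadditive => //; exact: bigcupT_measurable.
  apply: (@le_trans _ _ (\sum_(n <oo) (geometric 1 2^-1 n)%:E)%E).
    apply: lee_nneseries => n _; first by [].
    by rewrite -gap4; exact: superlevel_measure.
  apply: lime_le.
    by apply: is_cvg_nneseries => n _ _; rewrite lee_fin /= mul1r exprn_ge0// invr_ge0.
  apply: nearW => n; rewrite sumEFin lee_fin.
  have := @geometric_le_lim R n 1 2^-1 ler01.
  rewrite invr_gt0 ltr0n => /(_ isT); rewrite ger0_norm ?invr_ge0// => h.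
  apply: (le_trans (h _)); first by rewrite invf_lt1// ltr1n.
  by have -> : 1 - 2^-1 = 2^-1 :> R by [lra]; rewrite invrK mul1r.
have : (lambda `[0%R, (pi *+ 2)%R] <= lambda fat_set + lambda (\bigcup_n superlevel n))%E.
  apply: (@le_trans _ _ (lambda (fat_set `|` \bigcup_n superlevel n))); last first.
    by apply: measureU2; [exact: measurable_fat_set|exact: bigcupT_measurable].
  apply: le_measure; rewrite ?inE//.
    by apply: measurableU; [exact: measurable_fat_set|exact: bigcupT_measurable].
  move=> t t02; have := pselect (forall n, cos ((freq n)%:R * t) <= cos (gap n)).
  move=> [tfat|/existsNP[n tn]]; first by left.
  by right; exists n.
rewrite lebesgue_measure_itv/= lte_fin pmulrn_lgt0// pi_gt0 oppr0 adde0 => le_pi.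
have := le_trans le_pi (leeD2l _ sumB).
case: (lambda _) => [r|_|//]; last by rewrite leey.
rewrite -EFinD !lee_fin -mulr_natl.
by have := pi_ge2 R; lra.
Qed.

End fat_set.

(** * Transversal zeros accumulating on a set of positive measure *)

Lemma smooth_transversal_zeros (R : realType) :
  exists (A : set R) (S : nat -> R -> R),
  [/\ measurable A, (1%:E <= lebesgue_measure A)%E,
      forall k (x : R), is_derive x 1 (S k) (S k.+1 x),
      forall k, exists C, forall x, `|S k x| <= C
    & forall t e, A t -> 0 < e ->
        exists q, [/\ `|t - q| < e, S 0%N q = 0 & 0 < S 1%N q]].
Proof.
have [e [S [e0 dS bS cS]]] := smooth_series_exists (@bounded_smooth_bump R).
exists fat_set, S; split => //.
- exact: measurable_fat_set.
- exact: fat_set_measure.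
(* Then [2 * pi / r < n + 1 <= freq n], so the mesh of level [n] is smaller than [r]. *)
move=> t r At r0; pose n := Num.trunc (2 * pi / r).
have pi0 := pi_gt0 R.
have [k [q [qE tq low]]] := fat_set_grid n At.
have [z nn pos] := bump_grid qE low.
exists q; split.
- rewrite -(ltr_pM2r (@freqR_gt0 R n)) (le_lt_trans tq)//.
  rewrite [ltRHS]mulrC -ltr_pdivrMr//.
  by rewrite (lt_le_trans (truncnS_gt _))// ler_nat freq_gt.
- have := cS 0%N q.
  have -> : series (fun n => e n * derive1n 0 (bump n) q) = cst 0.
    by apply/funext => j; rewrite /series/= big1// => i _; rewrite z mulr0.
  by move=> c0; rewrite -(cvg_lim _ c0)//; exact: lim_cst.
- have c1 := cS 1%N q; rewrite -(cvg_lim _ c1)//.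
  (* All slopes at [q] are nonnegative, so the sum dominates its partial sum through index [n],
     whose last term is positive. *)
  apply: (@lt_le_trans _ _ (series (fun n => e n * derive1n 1 (bump n) q) n.+1)).
    rewrite /series/= big_nat_recr//= ltr_wpDl ?mulr_gt0//.
    by apply: sumr_ge0 => i _; rewrite mulr_ge0 ?nn// ltW.
  apply: nondecreasing_cvgn_le; last exact: cvgP c1.
  by apply: nondecreasing_series => i _ _; rewrite mulr_ge0 ?nn// ltW.
Qed.

(** * Functions of a single coordinate *)

Section coordinate_functions.
Context {R : realType} {m : nat}.
Implicit Types (g : R -> R) (x : 'rV[R]_m).

(* The difference quotients of [`|f|] at [q] have limit [`|l| != 0] in absolute
   value, but are nonnegative on the right and nonpositive on the left. *)
Lemma norm_not_derivable (f : R -> R) (q l : R) : is_derive q 1 f l ->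
  f q = 0 -> l != 0 -> ~ derivable (fun t => `|f t|) q 1.
Proof.
move=> [df dl] fq l0 /cvg_ex[/= d gd].
have cf : h^-1 *: (f (h *: 1 + q) - f q) @[h --> 0^'] --> l.
  by rewrite -dl; exact: df.
have d0 : 0 <= d.
  have pos : \forall h \near 0^'+, 0 <= h^-1 *: (`|f (h *: 1 + q)| - `|f q|).
    by near=> h; rewrite fq normr0 subr0 mulr_ge0// invr_ge0 ltW//.
  exact: ler_cvg_to (cvg_cst 0) (cvg_dnbhs_at_right gd) pos.
have d0' : d <= 0.
  have neg : \forall h \near 0^'-, h^-1 *: (`|f (h *: 1 + q)| - `|f q|) <= 0.
    by near=> h; rewrite fq normr0 subr0 mulr_le0_ge0// invr_le0 ltW//.
  exact: ler_cvg_to (cvg_dnbhs_at_left gd) (cvg_cst 0) neg.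
have dE : d = 0 by apply: le_anti; rewrite d0 d0'.
have nE : (fun h => `|h^-1 *: (f (h *: 1 + q) - f q)|) =
    (fun h => `|h^-1 *: (`|f (h *: 1 + q)| - `|f q|)|).
  by apply/funext => h; rewrite fq normr0 !subr0 !normrZ normr_id.
move: l0; apply/negP; rewrite negbK -normr_eq0 -(cvg_lim _ (cvg_norm cf))//.
by rewrite nE (cvg_lim _ (cvg_norm gd))// dE normr0.
Unshelve. all: by end_near. Qed.

Lemma coord_shift x (i : 'I_m) (h : R) :
  (h *: delta_mx 0 i + x) 0 i = h *: 1 + x 0 i.
Proof. by rewrite !mxE !eqxx. Qed.

Lemma derivable_coord g (i : 'I_m) x :
  derivable (fun y : 'rV[R]_m => g (y 0 i)) x (delta_mx 0 i) ->
  derivable g (x 0 i) 1.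
Proof.
rewrite /derivable/=.
by under eq_fun do rewrite coord_shift.
Qed.

Lemma is_derive_coord g dg (i j : 'I_m) x : is_derive (x 0 i) 1 g dg ->
  is_derive x (delta_mx 0 j) (fun y : 'rV[R]_m => g (y 0 i)) ((j == i)%:R * dg).
Proof.
move=> [dg1 dgE]; have [->|ji] := eqVneq j i.
  have E : (fun h => h^-1 *: (g ((h *: delta_mx 0 i + x) 0 i) - g (x 0 i))) =
      (fun h => h^-1 *: (g (h *: 1 + x 0 i) - g (x 0 i))).
    by apply/funext => h; rewrite coord_shift.
  rewrite mul1r; apply: DeriveDef; first by rewrite /derivable/= E; exact: dg1.
  by rewrite /derive/= E -dgE.
have E : (fun h => h^-1 *: (g ((h *: delta_mx 0 j + x) 0 i) - g (x 0 i))) = cst 0.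
  apply/funext => h; rewrite !mxE eqxx [i == j]eq_sym (negbTE ji) mulr0 add0r.
  by rewrite subrr scaler0.
rewrite mul0r; apply: DeriveDef; first by rewrite /derivable/= E; exact: is_cvg_cst.
by rewrite /derive/= E; exact: lim_cst.
Qed.

Lemma le_coord_norm x (i : 'I_m) : `|x 0 i| <= `|x|.
Proof.
rewrite [leRHS]mx_normrE.
exact: (@le_bigmax _ _ _ 0 (fun ij => `|x ij.1 ij.2|) (0, i)).
Qed.

Lemma continuous_coord g (i : 'I_m) :
  continuous g -> continuous (fun x : 'rV[R]_m => g (x 0 i)).
Proof.
move=> gc x; apply: (@continuous_comp _ _ _ (fun y : 'rV[R]_m => y 0 i) g).
  exact: coord_continuous.
exact: gc.
Qed.

(** The scalar [c] absorbs the factor [(j == i)%:R] of a partial derivative, so directions along and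
    across the coordinate share one induction. *)
Lemma Ck_on_coord (S : nat -> R -> R) (i : 'I_m) :
  (forall k (t : R), is_derive t 1 (S k) (S k.+1 t)) ->
  forall k n (c : R), Ck_on k setT (fun x : 'rV[R]_m => c * S n (x 0 i)).
Proof.
move=> dS; have cS n c : continuous (fun x : 'rV[R]_m => c * S n (x 0 i)).
  apply: (@continuous_coord (fun t => c * S n t)) => t.
  apply: continuousM; first exact: cvg_cst.
  by apply/differentiable_continuous/derivable1_diffP; exact: ex_derive.
elim=> [|k IH] n c; first by split=> // x _; exact: cS.
split=> [x _|j]; first exact: cS.
have dc x : is_derive x (delta_mx 0 j) (fun y : 'rV[R]_m => c * S n (y 0 i))
    ((j == i)%:R * c * S n.+1 (x 0 i)).
  rewrite -mulrA.
  by apply: (@is_derive_coord (fun t => c * S n t)); exact: is_deriveZ.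
split=> [x _|]; first exact: ex_derive.
suff -> : 'D_(delta_mx 0 j) (fun x : 'rV[R]_m => c * S n (x 0 i)) =
    (fun x => (j == i)%:R * c * S n.+1 (x 0 i)) by exact: IH.
by apply/funext => x; exact: derive_val.
Qed.

Lemma borel_open (U : set 'rV[R]_m) : open U -> borel U.
Proof. by move=> oU; exact: sub_sigma_algebra. Qed.

Lemma borel_setC (U : set 'rV[R]_m) : borel U -> borel (~` U).
Proof.
move=> bU; rewrite -setTD.
by have [_ + _] := smallest_sigma_algebra setT [set U : set 'rV[R]_m | open U]; apply.
Qed.

End coordinate_functions.

(** The pieces are [S 0 < 0] and its complement; the negative value and the zero make them
    nonempty. *)
Lemma piecewise_smooth_norm_coord (R : realType) (m : nat) (i : 'I_m)
    (S : nat -> R -> R) :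
  (forall k (t : R), is_derive t 1 (S k) (S k.+1 t)) ->
  (exists t, S 0%N t = 0) -> (exists t, S 0%N t < 0) ->
  piecewise_smooth (fun x : 'rV[R]_m => `|S 0%N (x 0 i)|).
Proof.
move=> dS [t0 St0] [t1 St1].
have cS : continuous (fun x : 'rV[R]_m => S 0%N (x 0 i)).
  apply: continuous_coord => t.
  by apply/differentiable_continuous/derivable1_diffP; exact: ex_derive.
split; first by move=> x; apply: continuous_comp; [exact: cS|exact: norm_continuous].
pose N := [set x : 'rV[R]_m | S 0%N (x 0 i) < 0].
have bN : borel N.
  apply: borel_open.
  have -> : N = (fun x => S 0%N (x 0 i)) @^-1` [set t | t < 0] by [].
  by apply: open_comp; [move=> x _; exact: cS|exact: open_lt].
exists 2%N, (fun j => if j == ord0 then N else ~` N),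
  (fun j x => (if j == ord0 then -1 else 1) * S 0%N (x 0 i)); split.
- move=> j; case: ifPn => _; split => //.
  + by exists (const_mx t1); rewrite /N/= mxE.
  + exact: borel_setC.
  + by exists (const_mx t0); rewrite /N/= mxE St0 ltxx.
- move=> j k _ _ [x []]; case: ifPn => [/eqP->|j0]; case: ifPn => [/eqP->|k0] //.
  have : forall a : 'I_2, a != ord0 -> a = ord_max.
    by move=> [[|[|//]] a2] //= _; exact/val_inj.
  by move=> E; rewrite (E _ j0) (E _ k0).
- rewrite -subTset => x _; have [Nx|Nx] := pselect (N x).
    by exists ord0.
  by exists ord_max.
- by move=> j k; exact: Ck_on_coord.
- move=> j x; case: ifPn => _.
    by rewrite /N/= => /ltr0_norm ->; rewrite mulN1r.
  by move=> /negP; rewrite -leNgt mul1r => /ger0_norm.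
Qed.

Theorem proposition4p5 (R : realType) (m : nat) (m_gt0 : (0 < m)%N) :
  exists f : 'rV[R]_m -> R,
    [/\ lipschitz f,
        piecewise_smooth f
      & exists A : set 'rV[R]_m,
          positive_lebesgue_measure A /\ forall x, A x -> ~ locally_C1 f x].
Proof.
case: m m_gt0 => [//|m] _.
have [A [S [mA A1 dS bS zS]]] := smooth_transversal_zeros R.
have [t At] : A !=set0.
  apply/set0P/negP => /eqP A0; move: A1; rewrite A0 measure0 lee_fin.
  by rewrite ler10.
have [q [_ Sq0 Sq1]] := zS t 1 At ltr01.
exists (fun x => `|S 0%N (x 0 ord0)|); split.
- have [C SC] := bS 1%N.
  have PF : ProperFilter (globally ([set: 'rV[R]_m.+1] `*` [set: 'rV[R]_m.+1])).
    exact: (@globally_properfilter _ _ (0, 0)).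
  apply: (@klipschitzW _ _ _ C _ _ PF) => -[x y] _ /=.
  apply: (le_trans (ler_dist_dist _ _)).
  apply: (le_trans (lipschitz_of_bounded_derive _ _ (dS 0%N) SC)).
  apply: ler_wpM2l; first exact: le_trans (normr_ge0 _) (SC 0).
  by have := le_coord_norm (x - y) ord0; rewrite !mxE.
- apply: piecewise_smooth_norm_coord => //; first by exists q.
  (* Were [S 0] nonnegative everywhere, it would equal its absolute value and be derivable at [q],
     against the kink there. *)
  apply: contrapT => /forallNP Sge0.
  apply: (norm_not_derivable (dS 0%N q) Sq0); first by rewrite gt_eqF.
  have -> : (fun t => `|S 0%N t|) = S 0%N.
    by apply/funext => s; rewrite ger0_norm// leNgt; exact/negP/Sge0.
  exact: ex_derive.
exists [set x | A (x 0 ord0)]; split; first split.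
- exact: caratheodory_cylinder.
- apply: lt_le_trans (lebesgue_outer_cylinder_ge ord0 mA ler01 A1).
  by rewrite expr1n lte_fin ltr01.
move=> x Ax [U [[oU Ux] [_ /(_ ord0)[dU _]]]].
have /nbhs_ballP[e /= e0 xU] : nbhs x U by exact: open_nbhs_nbhs.
(* Only coordinate [ord0] of [x] is moved, to a transversal zero [p] within [e]; in the sup norm the
   new point stays in the ball, hence in [U]. *)
have [p [xp Sp0 Sp1]] := zS _ e Ax e0.
have /dU/(@derivable_coord _ _ (fun t => `|S 0%N t|)) : U (set_coord x ord0 p).
  apply: xU; split=> // i j; rewrite mxE (ord1 i); case: eqP => [->|_].
    by rewrite -ball_normE.
  exact: ballxx.
rewrite mxE eqxx => dp.
by apply: (norm_not_derivable (dS 0%N p) Sp0) dp; rewrite gt_eqF.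
Qed.
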